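(* Let $\lambda,\rho\in\mathbb C$ with $\rho\ne0$, and let $\{P_n\}_{n\ge0}$ be the monic orthogonal polynomial sequence given in the context (Laguerre–Hahn of class $0$, analogous to Hermite, case 2). Then for every $n\ge0$, $$\widehat{\mathcal A}(x;n)P_{n+1}^{(4)}(x)+\widehat{\mathcal B}(x;n)P_{n+1}^{(3)}(x)+\widehat{\mathcal C}(x;n)P_{n+1}''(x)+\widehat{\mathcal D}(x;n)P_{n+1}'(x)+\widehat{\mathcal E}(x;n)P_{n+1}(x)=0,$$ where $$\begin{aligned} \widehat{\mathcal A}(x;n)={}&-8x^4(n+1)+4x^3\lambda(4n+3)-4x^2\big(\lambda^2+2n(\lambda^2-\rho+1)-\rho+3\big)\\ &-2x\lambda(4n(\rho-1)+\rho-5)-2n(\rho^2+2\rho-1)-3\lambda^2-2\rho+2,\\ \widehat{\mathcal B}(x;n)={}&32x^3(n+1)-12x^2\lambda(4n+3)+8x\big(\lambda^2+2n(\lambda^2-\rho+1)-\rho+3\big)\\ &+2\lambda(4n(\rho-1)+\rho-5),\\ \widehat{\mathcal C}(x;n)={}&32x^6(n+1)-16x^5\lambda(4n+3)-16x^4\big(2n^2+n(-2\lambda^2+2\rho)+\rho-3-\lambda^2\big)\\ &+8x^3\lambda\big(8n^2+4n(\rho+1)+\rho-3\big)\\ &-4x^2\big(8n^2(\lambda^2-\rho+1)+2n(4\lambda^2-\rho^2-2\rho+15)-\lambda^2-6\rho+22\big)\\ &-4x\lambda\big(8n^2(\rho-1)+n(8\rho-32)+2\rho-17\big)\\ &-2\big(9\lambda^2+4n^2(\rho^2-2\rho+1)+2n(9\lambda^2+2\rho^2+2\rho-8)+4(\rho+1)\big),\\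 \widehat{\mathcal D}(x;n)={}&32x^5(n+1)-32x^4\lambda(3n+2)+16x^3\big(2\lambda^2+4n(n+\lambda^2-\rho+2)-\rho+7\big)\\ &-8x^2\lambda\big(12n^2+n(-10\rho+27)-2\rho+21\big)\\ &+8x\big(7\lambda^2+4n^2(\lambda^2-\rho+1)+n(4\lambda^2+3\rho^2-20\rho+21)-\rho+5\big)\\ &+4\lambda(n+2)(4n(\rho-1)+\rho-5),\\ \widehat{\mathcal E}(x;n)={}&-32x^4(n+1)^3+16x^3\lambda(n+1)(4n^2+5n+2)\\ &-16x^2(n+1)\big(2n^2(\lambda^2-\rho+1)+n(\lambda^2-\rho+11)-\rho+7\big)\\ &-8x\lambda(n+1)\big(4n^2(\rho-1)-n(\rho+19)-7\big)\\ &-4(n+1)\big(2n^2(\rho^2-2\rho+2)+n(15\lambda^2-2\rho^2+14\rho-12)-2\rho+10\big). \end{aligned}$$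
   Context: The monic orthogonal polynomial sequence $\{P_n\}_{n\ge0}$ is defined by $P_0(x)=1$, $P_1(x)=x-\beta_0$, $P_{n+2}(x)=(x-\beta_{n+1})P_{n+1}(x)-\gamma_{n+1}P_n(x)$ for $n\ge0$, with $\beta_0=\lambda$, $\beta_{n+1}=0$ ($n\ge0$), $\gamma_1=\rho/2$, $\gamma_{n+1}=n/2$ ($n\ge1$). Its normalized form $u$ (the linear functional with $\langle u,1\rangle=1$ for which the sequence is orthogonal) is Laguerre–Hahn: the formal Stieltjes function $S(z)=-\sum_{n\ge0}\langle u,x^n\rangle z^{-n-1}$ satisfies $\Phi S'=BS^2+CS+D$ with $\Phi(x)=1$, $B(x)=2x^2-2\lambda x+1-\rho$, $C(x)=2x$, $D(x)=0$. $P_{n+1}^{(3)}$ and $P_{n+1}^{(4)}$ denote the third and fourth derivatives of $P_{n+1}$.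
   Formalization: The printed equation fails for every n≥1; three terms constant in x are corrected: in Â, −2n(ρ²+2ρ−1) becomes −2n(ρ²−2ρ+1); in Ĉ, 2n(9λ²+2ρ²+2ρ−8) becomes 2n(9λ²+2ρ²+2ρ−4); in Ê, 2n²(ρ²−2ρ+2) becomes 2n²(ρ²−2ρ+1). *)

(* Defs.v *)
From mathcomp Require Import all_boot all_order all_algebra.
From mathcomp Require Import reals.
From mathcomp Require Import complex.

Set Implicit Arguments.
Unset Strict Implicit.
Unset Printing Implicit Defensive.

Import GRing.Theory.
Local Open Scope ring_scope.

(* P_0 = 1, P_1 = x - beta_0,
   P_(m+2) = (x - beta_(m+1)) P_(m+1) - gamma_(m+1) P_m.
   The value gamma 0 is never used. *)
Fixpoint monic_ops (K : comNzRingType) (beta gamma : nat -> K) (n : nat)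
    : {poly K} :=
  match n with
  | 0 => 1
  | n1.+1 =>
    match n1 with
    | 0 => 'X - (beta 0)%:P
    | m.+1 => ('X - (beta n1)%:P) * monic_ops beta gamma n1
              - gamma n1 *: monic_ops beta gamma m
    end
  end.

Section HermiteCase2.
Variables (R : realType).
Implicit Types (lambda rho : R[i]) (n : nat).

Definition betaH lambda n : R[i] := if n is 0 then lambda else 0.

Definition gammaH rho n : R[i] :=
  match n with
  | 0 => 0
  | 1 => rho / 2
  | m.+2 => m.+1%:R / 2
  end.

Definition PH lambda rho n : {poly R[i]} :=
  monic_ops (betaH lambda) (gammaH rho) n.

(* The coefficients of the fourth-order equation. Three constant-in-x terms,
   marked (!), differ from the published formulas, which contain misprints:
   with the published constants the equation fails for every n >= 1 and all
   lambda, rho.  For instance, for n = 1, lambda = 0, rho = 1, where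
   P_2 = x^2 - 1/2, the published left-hand side equals 40 at x = 0. *)

(* (!) published: - 2n (rho^2 + 2 rho - 1) *)
Definition Ahat lambda rho n : {poly R[i]} :=
  let x := 'X in let l := lambda%:P in let r := rho%:P in
  let n := n%:R in
  - 8 * x ^+ 4 * (n + 1) + 4 * x ^+ 3 * l * (4 * n + 3)
  - 4 * x ^+ 2 * (l ^+ 2 + 2 * n * (l ^+ 2 - r + 1) - r + 3)
  - 2 * x * l * (4 * n * (r - 1) + r - 5)
  - 2 * n * (r ^+ 2 - 2 * r + 1) - 3 * l ^+ 2 - 2 * r + 2.

Definition Bhat lambda rho n : {poly R[i]} :=
  let x := 'X in let l := lambda%:P in let r := rho%:P in
  let n := n%:R in
  32 * x ^+ 3 * (n + 1) - 12 * x ^+ 2 * l * (4 * n + 3)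
  + 8 * x * (l ^+ 2 + 2 * n * (l ^+ 2 - r + 1) - r + 3)
  + 2 * l * (4 * n * (r - 1) + r - 5).

(* (!) published: 2n (9 lambda^2 + 2 rho^2 + 2 rho - 8) in the last line *)
Definition Chat lambda rho n : {poly R[i]} :=
  let x := 'X in let l := lambda%:P in let r := rho%:P in
  let n := n%:R in
  32 * x ^+ 6 * (n + 1) - 16 * x ^+ 5 * l * (4 * n + 3)
  - 16 * x ^+ 4
    * (2 * n ^+ 2 + n * (- 2 * l ^+ 2 + 2 * r) + r - 3 - l ^+ 2)
  + 8 * x ^+ 3 * l * (8 * n ^+ 2 + 4 * n * (r + 1) + r - 3)
  - 4 * x ^+ 2
    * (8 * n ^+ 2 * (l ^+ 2 - r + 1)
       + 2 * n * (4 * l ^+ 2 - r ^+ 2 - 2 * r + 15) - l ^+ 2 - 6 * r + 22)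
  - 4 * x * l * (8 * n ^+ 2 * (r - 1) + n * (8 * r - 32) + 2 * r - 17)
  - 2 * (9 * l ^+ 2 + 4 * n ^+ 2 * (r ^+ 2 - 2 * r + 1)
         + 2 * n * (9 * l ^+ 2 + 2 * r ^+ 2 + 2 * r - 4) + 4 * (r + 1)).

Definition Dhat lambda rho n : {poly R[i]} :=
  let x := 'X in let l := lambda%:P in let r := rho%:P in
  let n := n%:R in
  32 * x ^+ 5 * (n + 1) - 32 * x ^+ 4 * l * (3 * n + 2)
  + 16 * x ^+ 3 * (2 * l ^+ 2 + 4 * n * (n + l ^+ 2 - r + 2) - r + 7)
  - 8 * x ^+ 2 * l
    * (12 * n ^+ 2 + n * (- 10 * r + 27) - 2 * r + 21)
  + 8 * x
    * (7 * l ^+ 2 + 4 * n ^+ 2 * (l ^+ 2 - r + 1)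
       + n * (4 * l ^+ 2 + 3 * r ^+ 2 - 20 * r + 21) - r + 5)
  + 4 * l * (n + 2) * (4 * n * (r - 1) + r - 5).

(* (!) published: 2n^2 (rho^2 - 2 rho + 2) in the last line *)
Definition Ehat lambda rho n : {poly R[i]} :=
  let x := 'X in let l := lambda%:P in let r := rho%:P in
  let n := n%:R in
  - 32 * x ^+ 4 * (n + 1) ^+ 3
  + 16 * x ^+ 3 * l * (n + 1) * (4 * n ^+ 2 + 5 * n + 2)
  - 16 * x ^+ 2 * (n + 1)
    * (2 * n ^+ 2 * (l ^+ 2 - r + 1) + n * (l ^+ 2 - r + 11) - r + 7)
  - 8 * x * l * (n + 1) * (4 * n ^+ 2 * (r - 1) - n * (r + 19) - 7)
  - 4 * (n + 1)
    * (2 * n ^+ 2 * (r ^+ 2 - 2 * r + 1)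
       + n * (15 * l ^+ 2 - 2 * r ^+ 2 + 14 * r - 12) - 2 * r + 10).

End HermiteCase2.

(* Main.v *)
Require Import Defs.
From mathcomp Require Import all_boot all_order all_algebra.
From mathcomp Require Import reals complex.
From mathcomp Require Import ring.

(** The polynomials P_(n+1) and the monic Hermite polynomials H_n satisfy the
    same recurrence (with gamma_n = n/2) and the structure relations
    H_n' = 2x H_n - 2 H_(n+1) and P_(n+1)' = B H_n - 2 P_(n+2), where B is the
    polynomial of the Laguerre-Hahn equation Phi S' = B S^2 + C S + D.  Hence
    differentiation preserves the span of H_n, H_(n+1), P_(n+1), P_(n+2) over
    the polynomials, and acts on it by an explicit matrix.  The fourth-order
    equation is a linear relation between the coordinate vectors of P_(n+1) and
    its first four derivatives, which holds identically in x, n, lambda, rho. *)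

Import GRing.Theory Num.Theory.
Local Open Scope ring_scope.

Definition hermite {K : fieldType} (n : nat) : {poly K} :=
  monic_ops (fun=> 0) (fun k => k%:R / 2) n.

Definition lhB {K : comNzRingType} (lambda rho : K) : {poly K} :=
  2 * 'X ^+ 2 - 2 * lambda%:P * 'X + 1 - rho%:P.

Lemma mul2_scale_half {K : numFieldType} (a : K) (p : {poly K}) :
  2 * ((a / 2) *: p) = a *: p.
Proof.
by rewrite -polyC_natr mul_polyC scalerA mulrC divfK // pnatr_eq0.
Qed.

(** The recurrences are doubled to clear the halves in gamma for [ring]; this cancels the factor. *)
Lemma poly_mul2I {K : numFieldType} : injective (fun p : {poly K} => 2 * p).
Proof.
by move=> p q /= /mulfI; apply; rewrite -polyC_natr polyC_eq0 pnatr_eq0.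
Qed.

Lemma deriv_natM {K : comNzRingType} (k : nat) (p : {poly K}) :
  (k%:R * p)^`() = k%:R * p^`().
Proof. by rewrite !mulr_natl derivMn. Qed.

(** Differentiating the recurrence for 2 q_(n+2) produces an extra 2 q_(n+1), which is exactly the
    step from n+1 to n+2 in the recurrence for 2 q_(n+3). Applied with q = h = H, b = 2x, and with
    q_n = P_(n+1), b = B. *)
Lemma structure_relation {K : numFieldType} (h q : nat -> {poly K})
    (b : {poly K}) :
  (forall n, 2 * h n.+2 = 2 * 'X * h n.+1 - n.+1%:R * h n) ->
  (forall n, 2 * q n.+2 = 2 * 'X * q n.+1 - n.+1%:R * q n) ->
  (q 0)^`() = b * h 0 - 2 * q 1 ->
  (q 1)^`() = b * h 1 - 2 * q 2 ->
  forall n, (q n)^`() = b * h n - 2 * q n.+1.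
Proof.
move=> hrec qrec q0 q1 n.
suff: (q n)^`() = b * h n - 2 * q n.+1
      /\ (q n.+1)^`() = b * h n.+1 - 2 * q n.+2 by case.
elim: n => [//|n [IH0 IH1]]; split=> //; apply: poly_mul2I => /=.
rewrite -deriv_natM (qrec n) derivB -[2 * 'X * _]mulrA !deriv_natM derivM derivX.
rewrite IH0 IH1 (qrec n.+1).
ring: (hrec n) (qrec n).
Qed.

Lemma monic_opsSS {K : comNzRingType} (beta gamma : nat -> K) (n : nat) :
  monic_ops beta gamma n.+2
  = ('X - (beta n.+1)%:P) * monic_ops beta gamma n.+1
    - gamma n.+1 *: monic_ops beta gamma n.
Proof. by []. Qed.

Lemma hermite_rec {K : numFieldType} (n : nat) :
  2 * hermite n.+2 = 2 * 'X * hermite n.+1 - n.+1%:R * hermite n :> {poly K}.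
Proof.
rewrite {1}/hermite monic_opsSS polyC0 subr0 mulrBr mul2_scale_half mulrA.
by rewrite scaler_nat [n.+1%:R * _]mulr_natl.
Qed.

(** The exceptional lambda and rho/2 enter only P_1 and P_2; from P_3 on, gamma_(n+2) = (n+1)/2 is
    the Hermite coefficient shifted by one. *)
Lemma PH_rec {R : realType} (lambda rho : R[i]) (n : nat) :
  2 * PH lambda rho n.+3
  = 2 * 'X * PH lambda rho n.+2 - n.+1%:R * PH lambda rho n.+1.
Proof.
rewrite {1}/PH monic_opsSS polyC0 subr0 mulrBr mul2_scale_half mulrA.
by rewrite scaler_nat [n.+1%:R * _]mulr_natl.
Qed.

Lemma deriv_hermite {K : numFieldType} (n : nat) :
  (hermite n)^`() = 2 * 'X * hermite n - 2 * hermite n.+1 :> {poly K}.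
Proof.
apply: structure_relation; [exact: hermite_rec..| |];
  rewrite ?hermite_rec /hermite /= subr0 !derivE; ring.
Qed.

(** The recurrence eliminates H_(n+2), so the derivative stays in the span; [deriv_PHS] does the
    same for P_(n+3). *)
Lemma deriv_hermiteS {K : numFieldType} (n : nat) :
  (hermite n.+1)^`() = n.+1%:R * hermite n :> {poly K}.
Proof. by rewrite deriv_hermite hermite_rec; ring. Qed.

(** The case n = 0 forces B = 1 + 2 P_2. *)
Lemma deriv_PH {R : realType} (lambda rho : R[i]) (n : nat) :
  (PH lambda rho n.+1)^`()
  = lhB lambda rho * hermite n - 2 * PH lambda rho n.+2.
Proof.
have PH1 : PH lambda rho 1 = 'X - lambda%:P by [].
have PH2 : 2 * PH lambda rho 2 = 2 * 'X * PH lambda rho 1 - rho%:P.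
  rewrite {1}/PH monic_opsSS polyC0 subr0 mulrBr mul2_scale_half mulrA.
  by rewrite -mul_polyC mulr1.
have hermite1 : hermite 1 = 'X :> {poly R[i]} by rewrite /hermite /= subr0.
apply: (structure_relation _ (fun n => PH lambda rho n.+1)).
- exact: hermite_rec.
- exact: PH_rec.
- by rewrite PH2 PH1 /hermite /lhB /= !derivE; ring.
apply: poly_mul2I; rewrite /= -deriv_natM [in LHS]PH2 PH_rec PH1 hermite1.
rewrite derivB -mulrA deriv_natM !derivE [2 * 'X]mulrC -['X * 2 * _]mulrA PH2 PH1.
rewrite /lhB; ring.
Qed.

Lemma deriv_PHS {R : realType} (lambda rho : R[i]) (n : nat) :
  (PH lambda rho n.+2)^`()
  = lhB lambda rho * hermite n.+1 - 2 * 'X * PH lambda rho n.+2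
    + n.+1%:R * PH lambda rho n.+1.
Proof. by rewrite deriv_PH PH_rec; ring. Qed.

Lemma deriv_nat {K : comNzRingType} (k : nat) : (k%:R : {poly K})^`() = 0.
Proof. by rewrite -polyC_natr derivC. Qed.

Lemma deriv_lhB {K : comNzRingType} (lambda rho : K) :
  (lhB lambda rho)^`() = 4 * 'X - 2 * lambda%:P.
Proof.
by rewrite /lhB -polyC1 -!mulrA !(derivD, derivN) !deriv_natM !derivE; ring.
Qed.

(** Abstract polynomials keep the four generators, B and B' atomic for [ring]; [N] stands for the
    constant n+1. *)
Lemma iterated_derivatives {K : comNzRingType} (h0 h1 q0 q1 b b1 N : {poly K}) :
  h0^`() = 2 * 'X * h0 - 2 * h1 ->
  h1^`() = N * h0 ->
  q0^`() = b * h0 - 2 * q1 ->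
  q1^`() = b * h1 - 2 * 'X * q1 + N * q0 ->
  b^`() = b1 -> b1^`() = 4 -> N^`() = 0 ->
  [/\ q0^`()^`()
      = (b1 + 2 * 'X * b) * h0 - 4 * b * h1 - 2 * N * q0 + 4 * 'X * q1,
      q0^`()^`()^`()
      = (4 + 2 * b + 4 * 'X * b1 + 4 * 'X ^+ 2 * b - 6 * N * b) * h0
        - 6 * b1 * h1 + 4 * N * 'X * q0 + (4 + 4 * N - 8 * 'X ^+ 2) * q1
    & q0^`()^`()^`()^`()
      = (24 * 'X + 8 * 'X ^+ 3 * b + 12 * 'X * b + 6 * b1 + 12 * 'X ^+ 2 * b1
         - 12 * N * b1 - 8 * N * 'X * b) * h0
        + (- 32 - 8 * 'X * b1 + 16 * N * b - 16 * 'X ^+ 2 * b) * h1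
        + N * (8 + 4 * N - 8 * 'X ^+ 2) * q0
        + (- 24 * 'X - 16 * N * 'X + 16 * 'X ^+ 3) * q1].
Proof.
move=> dh0 dh1 dq0 dq1 db db1 dN.
pose dE := (@deriv_nat K, dN, db, db1, derivX, (dh0, dh1, dq0, dq1),
  (derivD, derivN, derivM)).
have E2 : q0^`()^`()
    = (b1 + 2 * 'X * b) * h0 - 4 * b * h1 - 2 * N * q0 + 4 * 'X * q1.
  by rewrite dq0 !dE; ring.
have E3 : q0^`()^`()^`()
    = (4 + 2 * b + 4 * 'X * b1 + 4 * 'X ^+ 2 * b - 6 * N * b) * h0
      - 6 * b1 * h1 + 4 * N * 'X * q0 + (4 + 4 * N - 8 * 'X ^+ 2) * q1.
  by rewrite E2 !dE; ring.
split=> //.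
(* [expr2] turns the square into a product, to which [derivM] applies. *)
by rewrite E3 expr2 !dE; ring.
Qed.

Theorem mainTheorem8 (R : realType) (lambda rho : R[i]) (hrho : rho != 0)
    (n : nat) :
  Ahat lambda rho n * (PH lambda rho n.+1)^`(4)
  + Bhat lambda rho n * (PH lambda rho n.+1)^`(3)
  + Chat lambda rho n * (PH lambda rho n.+1)^`(2)
  + Dhat lambda rho n * (PH lambda rho n.+1)^`()
  + Ehat lambda rho n * PH lambda rho n.+1 = 0.
Proof.
rewrite !derivnS derivn0.
have dB1 : (4 * 'X - 2 * lambda%:P)^`() = 4 :> {poly R[i]}.
  by rewrite derivB !deriv_natM !derivE; ring.
have [-> -> ->] := iterated_derivatives _ _ _ _ _ _ _
  (deriv_hermite n) (deriv_hermiteS n) (deriv_PH lambda rho n)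
  (deriv_PHS lambda rho n) (deriv_lhB lambda rho) dB1 (deriv_nat n.+1).
rewrite deriv_PH /Ahat /Bhat /Chat /Dhat /Ehat /lhB.
(* The coefficients of H_n, H_(n+1), P_(n+1) and P_(n+2) cancel separately. *)
ring.
Qed.
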